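(* Let $d \ge 2$ and let $f_d(x,y) = \sum_{i=0}^{d}\sum_{j=0}^{d} A_{(i,j)} x^i y^j \in \mathbb{C}[x,y]$ be a degree $d$ polynomial correspondence. Suppose that $f_d$ cannot be written as $f_d(x,y) = [g_k(x,y)]^{d/k}$ where $k \mid d$, $k \neq d$, and $g_k \in \mathbb{C}[x,y]$ is a map of $k$-tuples. Then $f_d$ is a map of $d$-tuples if and only if the variables $x$ and $y$ can be separated in the equation $f_d(x,y)=0$, i.e., the equation $f_d(x,y)=0$ can be rewritten as $\Phi(x)=\Psi(y)$, where $\Phi$ and $\Psi$ are fractional degree $d$ functions of the form $$\Phi(x) = \frac{\kappa_d x^d + \cdots + \kappa_1 x + \kappa_0}{\lambda_d x^d + \cdots + \lambda_1 x + \lambda_0}, \qquad \Psi(y) = \frac{\mu_d y^d + \cdots + \mu_1 y + \mu_0}{\nu_d y^d + \cdots + \nu_1 y + \nu_0},$$ with complex coefficients.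
   Context: $\widehat{\mathbb{C}} = \mathbb{C}\cup\{\infty\}$ is the Riemann sphere; $\widehat{\mathbb{C}}_x$ and $\widehat{\mathbb{C}}_y$ denote the copies in which $x$ and $y$ range. Degree $n$ polynomial correspondence ($n\ge 1$): a polynomial $f(x,y)=\sum_{0\le i,j\le n}A_{(i,j)}x^iy^j\in\mathbb{C}[x,y]$, of degree $n$ in each of the two variables, such that (1) $f(x,\cdot)$ and $f(\cdot,y)$ are generically $n$-valued (counting multiplicity), and (2) the biprojective completion $\Gamma_f$ of $\{f=0\}$ in $\widehat{\mathbb{C}}_x\times\widehat{\mathbb{C}}_y$ (the zero set of the bihomogenisation of $f$ of bidegree $(n,n)$) has no irreducible component of the form $\{a\}\times\widehat{\mathbb{C}}_y$ or $\widehat{\mathbb{C}}_x\times\{a\}$ with $a\in\widehat{\mathbb{C}}$. For $x,y$ in the Riemann sphere, $f(x,y)=0$ means $(x,y)\in\Gamma_f$. Map of $n$-tuples: let $f$ be a degree $n$ polynomial correspondence and $\Pi_x,\Pi_y$ the projections of $\Gamma_f$ to $\widehat{\mathbb{C}}_x,\widehat{\mathbb{C}}_y$. For $x_1\in\widehat{\mathbb{C}}_x$, let $y_1(x_1),\dots,y_n(x_1)$ be the points of $\Pi_y(\Pi_x^{-1}\{x_1\}\cap\Gamma_f)$ listed according to intersection multiplicity (equivalently, multiplicity as zeros of the bihomogenised $f(x_1,\cdot)$), and for each $j$ let $\{x_1,x_2(y_j(x_1)),\dots,x_n(y_j(x_1))\}$ be the list of points of $\Pi_x(\Pi_y^{-1}\{y_j(x_1)\}\cap\Gamma_f)$,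 repeated according to multiplicity. For $y_1\in\widehat{\mathbb{C}}_y$, define the points $x_j(y_1)$ and the lists $\{y_1,y_2(x_j(y_1)),\dots,y_n(x_j(y_1))\}$ in the same way with the roles of $x$ and $y$ interchanged. $f$ is a map of $n$-tuples if for each $x_1\in\widehat{\mathbb{C}}_x$ the $n$ lists $\{x_1,x_2(y_j(x_1)),\dots,x_n(y_j(x_1))\}$, $j=1,\dots,n$, coincide, and for each $y_1\in\widehat{\mathbb{C}}_y$ the $n$ lists $\{y_1,y_2(x_j(y_1)),\dots,y_n(x_j(y_1))\}$, $j=1,\dots,n$, coincide (lists being taken with multiplicity, irrespective of order). A fractional degree $d$ function is a rational map of degree $d$ of the Riemann sphere, written as a quotient of two polynomials of degree at most $d$. That $f_d(x,y)=0$ ''can be rewritten as'' $\Phi(x)=\Psi(y)$ means that, up to a nonzero constant multiple, $f_d(x,y)$ equals the polynomial obtained by clearing denominators, $\left(\sum_i\kappa_i x^i\right)\left(\sum_j\nu_j y^j\right)-\left(\sum_i\lambda_i x^i\right)\left(\sum_j\mu_j y^j\right)$. *)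

(* Defs.v *)
From HB Require Import structures.
From mathcomp Require Import all_boot all_order all_algebra.
From mathcomp Require Export polyXY.
From mathcomp Require Import complex.
From mathcomp Require Import boolp classical_sets reals.

Set Implicit Arguments.
Unset Strict Implicit.
Unset Printing Implicit Defensive.

Import GRing.Theory.
Local Open Scope classical_set_scope.
Local Open Scope ring_scope.

(* C[x, y] is {poly {poly C}}, with x the outer variable 'X and y the inner   *)
(* variable 'Y: the coefficient of x^i y^j in f is f`_i`_j.                   *)

Section Correspondences.
Variable C : closedFieldType.
Implicit Types (f : {poly {poly C}}) (p : {poly C}) (m n : nat).

(* The one-point completion of C; None is the point at infinity. *)
Definition sphere : Type := option C.

(* (u1, u0) with a = [u1 : u0] *)
Definition hcoord (a : sphere) : C * C :=
  if a is Some z then (z, 1) else (1, 0).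

(* The bihomogenisation of bidegree (m, n) of f, evaluated at the coordinates *)
(* of x and y chosen by hcoord.                                               *)
Definition bihom m n f (x y : sphere) : C :=
  \sum_(i < m.+1) \sum_(j < n.+1) f`_i`_j *
    ((hcoord x).1 ^+ i * (hcoord x).2 ^+ (m - i)) *
    ((hcoord y).1 ^+ j * (hcoord y).2 ^+ (n - j)).

Definition completion n f : set (sphere * sphere) :=
  [set q | bihom n n f q.1 q.2 = 0].

Definition zariski_closed (Z : set (sphere * sphere)) : Prop :=
  exists G : set (nat * nat * {poly {poly C}}),
    Z = [set q | forall m n g, G (m, n, g) -> bihom m n g q.1 q.2 = 0].

Definition zariski_irreducible (Z : set (sphere * sphere)) : Prop :=
  Z !=set0 /\
  forall A B, zariski_closed A -> zariski_closed B ->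
    Z `<=` A `|` B -> Z `<=` A \/ Z `<=` B.

Definition irreducible_component (W Z : set (sphere * sphere)) : Prop :=
  [/\ Z `<=` W, zariski_irreducible Z
    & forall Z', zariski_irreducible Z' -> Z `<=` Z' -> Z' `<=` W -> Z' = Z].

(* The binary form of degree n obtained by fixing the x-coordinates in the    *)
(* bihomogenisation of f, dehomogenised with respect to y.                    *)
Definition slice n f (x : sphere) : {poly C} :=
  \poly_(j < n.+1)
    \sum_(i < n.+1) f`_i`_j * ((hcoord x).1 ^+ i * (hcoord x).2 ^+ (n - i)).

(* The zeros on the sphere, repeated according to multiplicity, of the binary *)
(* form of degree n whose dehomogenisation is p: infinity is a zero of        *)
(* multiplicity n - deg p. Only meaningful for p != 0.                        *)
Definition form_zeros n p : seq sphere :=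
  map Some (sval (closed_field_poly_normal p)) ++ nseq (n.+1 - size p) None.

Definition y_list n f (x : sphere) : seq sphere := form_zeros n (slice n f x).

Definition x_list n f (y : sphere) : seq sphere := y_list n (swapXY f) y.

(* f(x, .) has n values, counted with multiplicity, outside finitely many x.  *)
Definition generically_valued n f : Prop :=
  exists s : seq sphere, forall x, x \notin s ->
    slice n f x != 0 /\ size (y_list n f x) = n.

Definition poly_correspondence n f : Prop :=
  [/\ (0 < n)%N,
      size f = n.+1 /\ sizeY f = n.+1,
      generically_valued n f /\ generically_valued n (swapXY f),
      forall a, ~ irreducible_component (completion n f) ([set a] `*` setT)
    & forall a, ~ irreducible_component (completion n f) (setT `*` [set a])].

Definition map_of_tuples n f : Prop :=
  [/\ poly_correspondence n f,
      forall x1, {in y_list n f x1 &, forall y y',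
        perm_eq (x_list n f y) (x_list n f y')}
    & forall y1, {in x_list n f y1 &, forall x x',
        perm_eq (y_list n f x) (y_list n f x')}].

(* The degree of the rational map p / q, read off its lowest terms.           *)
Definition ratmap_degree (p q : {poly C}) : nat :=
  (maxn (size (p %/ gcdp p q)) (size (q %/ gcdp p q))).-1.

(* p / q is a fractional degree d function. *)
Definition fractional d (p q : {poly C}) : Prop :=
  [/\ (size p <= d.+1)%N, (size q <= d.+1)%N, q != 0 & ratmap_degree p q = d].

(* f(x, y) = 0 can be rewritten as kappa(x) / lambda(x) = mu(y) / nu(y).      *)
Definition separable_variables d f : Prop :=
  exists kappa lambda mu nu : {poly C},
    [/\ fractional d kappa lambda, fractional d mu nu
      & exists2 c : C, c != 0 &
          f = c%:P *: (kappa^:P * nu%:P - lambda^:P * mu%:P)].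

End Correspondences.

(* Main.v *)
Require Import Defs.
From mathcomp Require Import all_boot all_order all_algebra.
From mathcomp Require Import boolp classical_sets reals complex.

Set Implicit Arguments.
Unset Strict Implicit.
Unset Printing Implicit Defensive.

Import GRing.Theory Num.Theory.
Local Open Scope classical_set_scope.
Local Open Scope ring_scope.
Local Open Scope complex_scope.

(** If f is c (kappa(x) nu(y) - lambda(x) mu(y)), every slice of f at a point x
    is a combination of nu and mu depending only on [kappa(x) : lambda(x)].
    Two points y, y' over the same x satisfy the same linear equation, so
    [mu(y) : nu(y)] = [mu(y') : nu(y')], and the slices at y and y' are
    proportional: they have the same zeros (separated_tuples).

    Conversely, let f be a map of d-tuples.  Suppose that for some y1 the
    polynomial h = f(., y1) has d distinct roots x_1, .., x_d.  The points x_i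
    all lie over y1, so the polynomials f(x_i, .) have the same zeros, i.e. they
    are multiples of one polynomial q.  Pick y0 with q(y0) != 0: then
    f(x, y) - f(x, y0) q(y) / q(y0) vanishes whenever x is one of the x_i, hence
    it is divisible by h(x), and for degree reasons the quotient is a polynomial
    r(y).  So f = f(x, y0) q(y) / q(y0) + h(x) r(y) is separated.  The fractions
    are in lowest terms, because a common zero of the two polynomials in x, say,
    would make f vanish on a vertical line (tuples_separable).

    A y1 with that property exists as soon as f has no repeated factor, f being
    then coprime to its x-derivative (squarefree_coprime_deriv), so it remains to
    show that a map of tuples is a power g ^+ m where g has no repeated factor;
    such a g is again a map of tuples (map_of_tuples_root), and
    the hypothesis of the theorem then forces m = 1.  Since no line is a
    component of the curve, all irreducible factors of f involve both x and y.
    Let p and q be irreducible factors of multiplicities k and l.  Choose a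
    generic a, a root b of p(a, .) and a root b' of q(a, .).  By genericity the
    multiplicity of a as a root of f(., b) is k, and as a root of f(., b') it
    is l (generic_mup); as b and b' both lie over a, the tuple property gives k = l
    (tuples_uniform_mult).  When all multiplicities equal m, f is an m-th power
    (uniform_power).

    Divisibility in C[x, y] is handled in (C[y])[x] up to factors of C[y], which
    Gauss's lemma removes (GaussY), and generic means outside the zeros of a
    nonzero polynomial in one variable; Bezout relations over C[y] provide these
    polynomials.  Finally, the condition on irreducible components of the
    completion of the curve is turned into the nonvanishing of all slices in
    line_component. *)

(** The specialisation of y; that of x is f.[a%:P]. *)
Local Notation evalY b := (map_poly (horner_eval b)).

(** * Zeros of binary forms *)

Section Forms.
Variable C : closedFieldType.
Implicit Types (f g : {poly {poly C}}) (p q r : {poly C}) (x y : sphere C).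

(** The value at the coordinates hcoord y of the binary form of degree n whose
    dehomogenisation is p. *)
Definition form_eval n p y : C :=
  \sum_(j < n.+1) p`_j * ((hcoord y).1 ^+ j * (hcoord y).2 ^+ (n - j)).

Lemma form_eval_fin n p z : (size p <= n.+1)%N -> form_eval n p (Some z) = p.[z].
Proof.
move=> sp; rewrite (horner_coef_wide z sp); apply: eq_bigr => j _ /=.
by rewrite expr1n mulr1.
Qed.

Lemma form_eval_inf n p : form_eval n p None = p`_n.
Proof.
rewrite /form_eval big_ord_recr /= subnn expr0 mulr1 expr1n mulr1.
rewrite big1 ?add0r // => j _.
by rewrite /= expr0n subn_eq0 leqNgt ltn_ord !mulr0.
Qed.

(** An algebraically closed field is infinite, so the finite points suffice. *)
Lemma form_eval_vanish n p :
  (size p <= n.+1)%N -> (forall y, form_eval n p y = 0) -> p = 0.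
Proof.
move=> sp p0; apply/eqP/negPn/negP => /closed_nonrootP[z].
by rewrite rootE -(form_eval_fin _ sp) p0 eqxx.
Qed.

Lemma mupZ (c a : C) p : c != 0 -> mup a (c *: p) = mup a p.
Proof. by move=> c0; rewrite -mul_polyC mupMr // rootC. Qed.

Lemma mupX (a : C) p n : p != 0 -> mup a (p ^+ n) = (n * mup a p)%N.
Proof.
move=> p0; elim: n => [|n IH]; first by rewrite expr0 mul0n mupNroot ?root1.
by rewrite exprS mupM ?expf_neq0 // IH mulSn.
Qed.

Lemma mup_gt0 (a : C) p : p != 0 -> (0 < mup a p)%N = root p a.
Proof. by move=> p0; rewrite -XsubC_dvd // dvdp_XsubCl. Qed.

Lemma count_form_zeros_fin n p a :
  p != 0 -> count_mem (Some a) (form_zeros n p) = mup a p.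
Proof.
move=> p0; rewrite /form_zeros count_cat count_nseq /= mul0n addn0 count_map.
case: (closed_field_poly_normal p) => s /= def_p.
rewrite def_p mupZ ?lead_coef_eq0 // mu_prod_XsubC.
by apply: eq_count => z /=; apply/eqP/eqP => [[->]|->].
Qed.

Lemma count_form_zeros_inf n p :
  count_mem None (form_zeros n p) = (n.+1 - size p)%N.
Proof.
rewrite /form_zeros count_cat count_nseq /= mul1n count_map.
by rewrite (eq_count (a2 := pred0)) ?count_pred0.
Qed.

Lemma mem_form_zeros n p y : p != 0 -> (size p <= n.+1)%N ->
  (y \in form_zeros n p) = (form_eval n p y == 0).
Proof.
move=> p0 sp; rewrite -has_pred1 has_count; case: y => [z|].
  by rewrite count_form_zeros_fin // mup_gt0 // form_eval_fin.
rewrite count_form_zeros_inf subn_gt0 form_eval_inf ltnS.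
apply/idP/eqP => [/leq_sizeP -> //|pn0]; apply/leq_sizeP => j.
rewrite leq_eqVlt => /orP[/eqP <- //|nj]; exact: nth_default (leq_trans sp nj).
Qed.

Lemma size_form_zeros n p : p != 0 -> (size p <= n.+1)%N ->
  size (form_zeros n p) = n.
Proof.
move=> p0 sp; rewrite /form_zeros size_cat size_nseq size_map.
case: (closed_field_poly_normal p) => s /= def_p.
have ss: size p = (size s).+1.
  by rewrite def_p size_scale ?lead_coef_eq0 // size_prod_XsubC.
by move: sp; rewrite ss subSS ltnS => /subnKC.
Qed.

Lemma perm_form_zerosZ n c p : c != 0 -> p != 0 ->
  perm_eq (form_zeros n (c *: p)) (form_zeros n p).
Proof.
move=> c0 p0; apply/allP => -[z|] _ /=; apply/eqP.
  by rewrite !count_form_zeros_fin ?scaler_eq0 ?negb_or ?c0 // mupZ.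
by rewrite !count_form_zeros_inf size_scale.
Qed.

(** The finite zeros suffice: over an algebraically closed field they give the
    factorization into linear factors. *)
Lemma perm_form_zeros_prop n p q : p != 0 -> q != 0 ->
  perm_eq (form_zeros n p) (form_zeros n q) ->
  p = (lead_coef p / lead_coef q) *: q.
Proof.
move=> p0 q0 /permP pq.
case: (closed_field_poly_normal p) (@count_form_zeros_fin n p) => s def_p cp.
case: (closed_field_poly_normal q) (@count_form_zeros_fin n q) => t def_q cq.
have st: perm_eq s t.
  apply/allP => z _ /=; apply/eqP; rewrite -!mu_prod_XsubC.
  rewrite -(mupZ _ _ (_ : lead_coef p != 0)) ?lead_coef_eq0 // -def_p.
  rewrite -(mupZ _ (\prod_(_ <- t) _) (_ : lead_coef q != 0)) ?lead_coef_eq0 //.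
  by rewrite -def_q -cp // -cq // pq.
rewrite {1}def_p (perm_big _ st) {2}def_q scalerA divfK ?lead_coef_eq0 //.
Qed.

Lemma size_expf (R : idomainType) (p : {poly R}) m : p != 0 ->
  size (p ^+ m) = ((size p).-1 * m).+1.
Proof.
by move=> p0; rewrite -size_exp prednK // size_poly_gt0 expf_neq0.
Qed.

(** The two forms have degrees k * m and k: their zeros at infinity are computed
    from these degrees, and are multiplied by m as well. *)
Lemma count_form_zerosX k m p y : p != 0 ->
  count_mem y (form_zeros (k * m) (p ^+ m)) =
    (m * count_mem y (form_zeros k p))%N.
Proof.
move=> p0; case: y => [z|].
  by rewrite !count_form_zeros_fin ?expf_neq0 // mupX.
rewrite !count_form_zeros_inf size_expf // subSS -mulnBl mulnC.
by rewrite -{2}(prednK (_ : 0 < size p)%N) ?size_poly_gt0.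
Qed.

End Forms.

(** * Slices of a correspondence and lines in the curve *)

Section Slices.
Variable C : closedFieldType.
Implicit Types (f g : {poly {poly C}}) (p q r : {poly C}) (x y : sphere C).

(** The slice of a bihomogenisation of arbitrary bidegree.  The case m != n is
    needed for the cofactor of a power of x - a in a form of bidegree (n, n). *)
Definition bislice m n f x : {poly C} :=
  \poly_(j < n.+1)
    \sum_(i < m.+1) f`_i`_j * ((hcoord x).1 ^+ i * (hcoord x).2 ^+ (m - i)).

Lemma size_bislice m n f x : (size (bislice m n f x) <= n.+1)%N.
Proof. exact: size_poly. Qed.

Lemma bihomE m n f x y : bihom m n f x y = form_eval n (bislice m n f x) y.
Proof.
rewrite /bihom exchange_big; apply: eq_bigr => j _ /=.
by rewrite coef_poly ltn_ord mulr_suml.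
Qed.

Lemma bislice_fin m n f (a : C) : (size f <= m.+1)%N -> (sizeY f <= n.+1)%N ->
  bislice m n f (Some a) = f.[a%:P].
Proof.
move=> sf sYf; rewrite (horner_coef_wide _ sf); apply/polyP => j.
rewrite coef_poly coef_sum; case: ltnP => [_|nj].
  apply: eq_bigr => i _ /=.
  by rewrite expr1n mulr1 -polyC_exp coefMC.
rewrite big1 // => i _; rewrite -polyC_exp coefMC nth_default ?mul0r //.
exact: leq_trans (max_size_coefXY _ _) (leq_trans sYf nj).
Qed.

Lemma bislice_inf m n f : (sizeY f <= n.+1)%N -> bislice m n f None = f`_m.
Proof.
move=> sYf; apply/polyP => j; rewrite coef_poly; case: ltnP => [_|nj].
  rewrite big_ord_recr /= subnn expr0 mulr1 expr1n mulr1 big1 ?add0r // => i _.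
  by rewrite expr0n subn_eq0 leqNgt ltn_ord !mulr0.
by rewrite nth_default // (leq_trans (max_size_coefXY _ _) (leq_trans sYf nj)).
Qed.

Lemma sliceE n f x : slice n f x = bislice n n f x.
Proof. by []. Qed.

Lemma size_slice n f x : (size (slice n f x) <= n.+1)%N.
Proof. exact: size_poly. Qed.

Lemma bihom_swap m n f x y : bihom n m (swapXY f) y x = bihom m n f x y.
Proof.
rewrite /bihom exchange_big; apply: eq_bigr => i _; apply: eq_bigr => j _.
by rewrite coef_swapXY mulrAC.
Qed.

Lemma evalYE f (b : C) : (swapXY f).[b%:P] = evalY b f.
Proof. exact: horner_swapXY. Qed.

Lemma sizeYM f g : f != 0 -> g != 0 ->
  sizeY (f * g) = (sizeY f + sizeY g).-1.
Proof.
by move=> f0 g0; rewrite !sizeYE rmorphM size_mul ?swapXY_eq0.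
Qed.

Lemma line_closed (a : C) : zariski_closed ([set Some a] `*` [set: sphere C]).
Proof.
exists [set (1%N, 0%N, 'X - a%:P%:P)].
have sY: (sizeY ('X - a%:P%:P : {poly {poly C}}) <= 1)%N.
  rewrite sizeYE rmorphB /= swapXY_X swapXY_polyC map_polyC /=.
  by rewrite -polyCB size_polyC; case: (_ == _).
apply/seteqP; split=> -[x y] /=.
  move=> [-> _] m n _ [-> -> ->].
  rewrite bihomE bislice_fin ?size_XsubC // hornerXsubC subrr.
  by rewrite /form_eval big1 // => j _; rewrite coef0 mul0r.
move=> /(_ _ _ _ erefl); rewrite bihomE; case: x => [x|].
  rewrite bislice_fin ?size_XsubC // hornerXsubC -polyCB.
  rewrite /form_eval big_ord_recr big_ord0 /= add0r coefC /= !expr0 !mulr1.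
  by move/eqP; rewrite subr_eq0 => /eqP ->.
rewrite bislice_inf // coefB coefX coefC /= subr0.
rewrite /form_eval big_ord_recr big_ord0 /= add0r coefC /= !expr0 !mulr1.
by move/eqP; rewrite oner_eq0.
Qed.

(** A closed set that does not contain the line meets it in the zeros of a
    nonzero form, so two such sets miss a common point of the line. *)
Lemma line_irreducible (a : sphere C) :
  zariski_irreducible ([set a] `*` [set: sphere C]).
Proof.
split; first by exists (a, None).
move=> A B [GA ->] [GB ->] lAB.
have [|nA] := pselect (forall y, [set q | forall m n g, GA (m, n, g) ->
  bihom m n g q.1 q.2 = 0] (a, y)).
  by move=> lA; left=> -[x y] /= [-> _]; exact: lA.
right=> -[x y] /= [-> _] m n g Gg; apply: contrapT => /eqP gy; apply: nA => y'.
move=> m' n' g' Gg' /=; apply: contrapT => /eqP gy'.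
have nz k l h z : bihom k l h a z != 0 -> bislice k l h a != 0.
  apply: contraNneq => h0; rewrite bihomE h0.
  by rewrite /form_eval big1 // => j _; rewrite coef0 mul0r.
have := mulf_neq0 (nz _ _ _ _ gy) (nz _ _ _ _ gy').
move=> /closed_nonrootP[z]; rewrite rootM negb_or => /andP[gz gz'].
have [] := lAB (a, Some z) (conj erefl I) => /=.
  move=> /(_ _ _ _ Gg')/eqP; rewrite bihomE form_eval_fin ?size_bislice //.
  by rewrite -rootE (negPf gz').
move=> /(_ _ _ _ Gg)/eqP; rewrite bihomE form_eval_fin ?size_bislice //.
by rewrite -rootE (negPf gz).
Qed.

(** Write f = (x - a) ^+ k * g with g not divisible by x - a.  The curve is the
    union of the line x = a and of the closed set V of zeros of g; an
    irreducible subset of the curve that contains the line is not inside V, so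
    it is inside the line. *)
Lemma line_component n f (a : C) : size f = n.+1 -> sizeY f = n.+1 ->
  f.[a%:P] = 0 ->
  irreducible_component (completion n f) ([set Some a] `*` setT).
Proof.
move=> sf sYf fa0.
have f0 : f != 0 by rewrite -size_poly_eq0 sf.
split; [|exact: line_irreducible|].
- move=> -[x y] /= [-> _]; rewrite /completion /= bihomE bislice_fin ?sf ?sYf //.
  by rewrite fa0 /form_eval big1 // => j _; rewrite coef0 mul0r.
move=> Z' [_ Z'irr] lZ' Z'W.
have [k [g ga def_f]] := multiplicity_XsubC f a%:P.
move: ga; rewrite f0 /= rootE => ga.
have g0 : g != 0 by apply: contraNneq ga => ->; rewrite horner0.
have X0 : ('X - a%:P%:P : {poly {poly C}}) ^+ k != 0.
  by rewrite expf_neq0 // polyXsubC_eq0.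
have sYg : sizeY g = n.+1.
  rewrite -sYf def_f sizeYM // sizeYE [X in (_ + X)%N]sizeYE.
  rewrite rmorphXn rmorphB /= swapXY_X swapXY_polyC map_polyC /=.
  rewrite -polyCB -polyC_exp size_polyC expf_neq0 ?addn1 //.
  by rewrite polyXsubC_eq0.
have sg : (size g + k = n.+1)%N.
  by rewrite -sf def_f size_mul // size_exp_XsubC addnS.
have kn : (k <= n)%N.
  rewrite -ltnS -sg -[X in (X < _)%N]add0n ltn_add2r size_poly_gt0 //.
have sg' : size g = (n - k).+1 by rewrite -subSn // -sg addnK.
(* g has bidegree (n - k, n) *)
pose G : set (nat * nat * {poly {poly C}}) := [set ((n - k)%N, n, g)].
pose V : set (sphere C * sphere C) :=
  [set q | forall i j (h : {poly {poly C}}), G (i, j, h) ->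
    bihom i j h q.1 q.2 = 0].
have closedV : zariski_closed V by exists G.
have := Z'irr _ V (line_closed a) closedV.
case.
- move=> [x y] /Z'W; rewrite /completion /= => W.
  have [->|xa] := pselect (x = Some a); [by left|right].
  move=> _ _ _ [-> -> ->] /=; move: W; rewrite !bihomE; case: x xa => [x|_].
    move=> xa.
    rewrite !bislice_fin ?sf ?sYf ?sg' ?sYg // def_f hornerM horner_exp.
    rewrite hornerXsubC -polyCB -polyC_exp mulrC /form_eval => W.
    have c0 : (x - a) ^+ k != 0.
      by rewrite expf_neq0 // subr_eq0; apply/eqP => xa'; apply: xa; rewrite xa'.
    apply: (mulfI c0); rewrite mulr0 -{}[RHS]W mulr_sumr.
    by apply: eq_bigr => j _; rewrite coefCM mulrA.
  rewrite !bislice_inf ?sYf ?sYg //.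
  have -> : f`_n = g`_(n - k).
    have -> : f`_n = lead_coef f by rewrite lead_coefE sf.
    rewrite def_f lead_coefM lead_coef_exp lead_coefXsubC expr1n mulr1.
    by rewrite lead_coefE sg'.
  by [].
- by move=> Z'l; apply/seteqP; split.
move=> Z'V; case/negP: ga; apply/eqP.
apply: (@form_eval_vanish _ n) => [|y].
  by rewrite -sYg max_size_evalC.
rewrite -(@bislice_fin (n - k) n) ?sg' ?sYg // -bihomE.
exact: (Z'V (Some a, y) (lZ' (_, _) (conj erefl I)) _ _ _ erefl).
Qed.

(** The exchange of the coordinates is a homeomorphism. *)
Lemma component_swap n f (Z : set (sphere C)) (T : set (sphere C)) :
  irreducible_component (completion n (swapXY f)) (Z `*` T) ->
  irreducible_component (completion n f) (T `*` Z).
Proof.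
pose s (q : sphere C * sphere C) := (q.2, q.1).
have sK A : s @^-1` (s @^-1` A) = A by apply/seteqP; split=> -[].
have sub A B : A `<=` B -> s @^-1` A `<=` s @^-1` B by move=> AB [x y] /AB.
have closed_s A : zariski_closed A -> zariski_closed (s @^-1` A).
  move=> [G ->]; exists [set t | G (t.1.2, t.1.1, swapXY t.2)].
  apply/seteqP; split=> -[x y] /= H m n' g Gg.
    by rewrite -bihom_swap; apply: H.
  by rewrite -[g]swapXYK bihom_swap; apply: H; rewrite /= swapXYK.
have irr_s A : zariski_irreducible A -> zariski_irreducible (s @^-1` A).
  move=> [[[x y] Axy] irrA]; split; first by exists (y, x).
  move=> B D cB cD AB.
  have := irrA _ _ (closed_s _ cB) (closed_s _ cD).
  case; first by move=> [u v] Auv; exact: (AB (v, u) Auv).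
    by move/sub; rewrite sK; left.
  by move/sub; rewrite sK; right.
have comp_s : s @^-1` completion n (swapXY f) = completion n f.
  by apply/seteqP; split=> -[x y]; rewrite /completion /= bihom_swap.
have prod_s : s @^-1` (Z `*` T) = T `*` Z.
  by apply/seteqP; split=> -[x y] /= [].
move=> [ZW irrZ maxZ]; rewrite -comp_s -prod_s; split.
- exact: sub.
- exact: irr_s.
move=> Z' irrZ' lZ' Z'W; rewrite -[Z']sK; congr (s @^-1` _).
apply: maxZ; first exact: irr_s.
  by rewrite -[_ `*` _]sK; apply: sub.
by rewrite -[completion _ _]sK; apply: sub.
Qed.

Definition line_free f : Prop :=
  (forall a : C, f.[a%:P] != 0) /\ (forall b : C, evalY b f != 0).

(** A slice that vanishes identically is a line of the curve, which would be one
    of its irreducible components. *)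
Lemma poly_correspondence_line_free n f :
  poly_correspondence n f -> line_free f.
Proof.
move=> [n0 [sf sYf] _ noX noY]; split=> a; apply/eqP => fa0.
  exact: (noX (Some a) (line_component sf sYf fa0)).
apply: (noY (Some a)); apply: component_swap; apply: line_component.
- by rewrite -sizeYE.
- by rewrite sizeYE swapXYK.
- by rewrite evalYE.
Qed.

Lemma poly_correspondence_swap n f :
  poly_correspondence n f -> poly_correspondence n (swapXY f).
Proof.
move=> [n0 [sf sYf] [gx gy] noX noY]; split=> //.
- by split; rewrite ?sizeYE ?swapXYK -?sizeYE.
- by rewrite swapXYK.
- by move=> a /component_swap; exact: noY.
by move=> a H; apply: (noX a); apply: component_swap; rewrite ?swapXYK.
Qed.

(** At infinity the slice is the leading coefficient, which is nonzero because
    the degree in x is exactly n. *)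
Lemma slice_neq0 n f x : poly_correspondence n f -> slice n f x != 0.
Proof.
move=> pf; have [n0 [sf sYf] _ _ _] := pf.
rewrite sliceE; case: x => [a|].
  by rewrite bislice_fin ?sf ?sYf //; case: (poly_correspondence_line_free pf).
rewrite bislice_inf ?sYf //.
have -> : f`_n = lead_coef f by rewrite lead_coefE sf.
by rewrite lead_coef_eq0 -size_poly_eq0 sf.
Qed.

End Slices.

(** * Factorization of line-free polynomials *)

Section Factor.
Variable C : closedFieldType.
Implicit Types (f g p q r u v w : {poly {poly C}}) (c d : {poly C}) (a b : C).

Lemma line_freeM f g : line_free (f * g) <-> line_free f /\ line_free g.
Proof.
split=> [[fx fy]|[[fx fy] [gx gy]]].
  split; split=> a.
  - by have:= fx a; rewrite hornerM mulf_eq0 negb_or => /andP[].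
  - by have:= fy a; rewrite rmorphM mulf_eq0 negb_or => /andP[].
  - by have:= fx a; rewrite hornerM mulf_eq0 negb_or => /andP[].
  - by have:= fy a; rewrite rmorphM mulf_eq0 negb_or => /andP[].
split=> a; first by rewrite hornerM; apply: mulf_neq0.
by rewrite rmorphM /=; apply: mulf_neq0; [apply: fy|apply: gy].
Qed.

Lemma line_free_neq0 f : line_free f -> f != 0.
Proof. by move=> [/(_ 0)+ _]; apply: contraNneq => ->; rewrite horner0. Qed.

Lemma line_free_swap f : line_free f -> line_free (swapXY f).
Proof.
move=> [fx fy]; split=> a; first by rewrite evalYE; apply: fy.
by rewrite -evalYE swapXYK; apply: fx.
Qed.

(** Consequently the degree in x alone measures how far a line-free polynomial
    is from being a constant, and inductions can be done on it. *)
Lemma line_free_const f : line_free f -> (size f <= 1)%N ->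
  exists2 a : C, a != 0 & f = a%:P%:P.
Proof.
move=> [fx fy] /size1_polyC def_f; pose c := f`_0.
have c_neq0 b : c.[b] != 0.
  by have:= fy b; rewrite def_f map_polyC polyC_eq0.
have /size_poly1P[a a0 def_c]: size c == 1%N.
  by apply: contraT => /closed_rootP[b]; rewrite rootE (negPf (c_neq0 b)).
by exists a => //; rewrite def_f -/c def_c.
Qed.

Lemma line_free_sizeY f : line_free f -> (1 < size f)%N -> (1 < sizeY f)%N.
Proof.
move=> lf; rewrite !ltnNge; apply: contra; rewrite sizeYE => sf.
have [a a0 /(congr1 swapXY)] := line_free_const (line_free_swap lf) sf.
by rewrite swapXYK swapXY_polyC map_polyC => ->; rewrite size_polyC leq_b1.
Qed.

Lemma evalY_factor f b : evalY b f = 0 -> exists g, f = ('X - b%:P)%:P * g.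
Proof.
rewrite -evalYE => /eqP /factor_theorem[g /(congr1 swapXY)].
rewrite swapXYK rmorphM rmorphB /= swapXY_X swapXY_polyC map_polyC /= -polyCB.
by move=> ->; exists (swapXY g); rewrite mulrC.
Qed.

Lemma evalY_polyC c b : evalY b c%:P = c.[b]%:P.
Proof. by rewrite map_polyC. Qed.

Definition primitiveY g := forall b, evalY b g != 0.

(** Divide by factors y - b as long as possible; each division lowers the degree
    in y. *)
Lemma primitive_partY f : f != 0 ->
  exists c g, [/\ c != 0, primitiveY g & f = c%:P * g].
Proof.
have [n] := ubnP (sizeY f); elim: n f => // n IH f sf f0.
have [|/existsNP[b /negP/negPn/eqP/evalY_factor[g def_f]]] :=
  pselect (primitiveY f).
  by exists 1, f; rewrite oner_eq0 mul1r.
have g0 : g != 0 by apply: contraNneq f0 => g0; rewrite def_f g0 mulr0.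
have X0 : ('X - b%:P : {poly C})%:P != 0 by rewrite polyC_eq0 polyXsubC_eq0.
have [|c [h [c0 hp def_g]]] := IH g _ g0.
  rewrite -ltnS (leq_trans _ sf) // def_f sizeYM //.
  by rewrite [sizeY _%:P]sizeYE swapXY_polyC size_map_polyC size_XsubC.
exists (('X - b%:P) * c), h; split=> //; first by rewrite mulf_neq0 ?polyXsubC_eq0.
by rewrite def_f def_g mulrA polyCM.
Qed.

(** Gauss's lemma: at a root b of c the product w * g specialises to 0 while g
    does not, so y - b divides w and can be cancelled. *)
Lemma GaussY c p w g : c != 0 -> primitiveY g ->
  c%:P * p = w * g -> exists w', p = w' * g.
Proof.
move=> + gp; have [n] := ubnP (size c); elim: n c w => // n IH c w sc c0 eqp.
have [/size_poly1P[a a0 def_c]|/closed_rootP[b cb]] := boolP (size c == 1%N).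
  exists (a^-1%:P%:P * w); rewrite -mulrA -eqp mulrA def_c -!polyCM mulVf //.
  by rewrite !polyC1 mul1r.
have /factor_theorem[c1 def_c] := cb.
have c10 : c1 != 0 by apply: contraNneq c0 => c10; rewrite def_c c10 mul0r.
have: evalY b w * evalY b g = 0.
  by rewrite -rmorphM -eqp rmorphM /= evalY_polyC (rootP cb) mul0r.
move/eqP; rewrite mulf_eq0 (negPf (gp b)) orbF => /eqP /evalY_factor[w1 def_w].
apply: (IH c1 w1) => //.
  by rewrite -ltnS (leq_trans _ sc) // def_c size_mul ?polyXsubC_eq0 // size_XsubC addn2.
have X0 : ('X - b%:P : {poly C})%:P != 0 by rewrite polyC_eq0 polyXsubC_eq0.
by apply: (mulfI X0); rewrite [RHS]mulrA -def_w -eqp def_c mulrA -polyCM [_ * c1]mulrC.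
Qed.

(** A gcd over C[y] divides p and q only up to factors in C[y]; its primitive
    part divides them in C[x, y]. *)
Lemma common_factor p q : p != 0 -> ~~ coprimep p q ->
  exists g u v, [/\ (1 < size g)%N, p = u * g & q = v * g].
Proof.
move=> p0; rewrite /coprimep => npq.
have G0 : gcdp p q != 0 by rewrite gcdp_eq0 negb_and p0.
have sG : (1 < size (gcdp p q))%N by rewrite ltn_neqAle eq_sym npq size_poly_gt0.
have [c [g [c0 gp def_G]]] := primitive_partY G0.
have sg : (1 < size g)%N.
  move: sG; rewrite def_G size_mul ?polyC_eq0 //; last first.
    by apply: contraNneq G0 => g0; rewrite def_G g0 mulr0.
  by rewrite size_polyC c0.
have dvd h : gcdp p q %| h -> exists u, h = u * g.
  move=> /Pdiv.Idomain.dvdpP[[e w] /= e0].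
  by rewrite def_G mulrA -mul_polyC; apply: GaussY.
have [u pu] := dvd _ (dvdp_gcdl p q); have [v qv] := dvd _ (dvdp_gcdr p q).
by exists g, u, v.
Qed.

(** The size only sees the degree in x, but the factors of a line-free
    polynomial are line-free, and those of size 1 are constants: this is
    irreducibility in C[x, y]. *)
Definition irred p := [/\ line_free p, (1 < size p)%N
  & forall u v, p = u * v -> size u = 1%N \/ size v = 1%N].

(** If not coprime to q, the irreducible p is itself, up to a constant, the common
    factor. *)
Lemma irred_coprime p q : irred p -> coprimep p q \/ exists w, q = w * p.
Proof.
move=> [lp sp irrp].
have [|npq] := boolP (coprimep p q); [by left|right].
have [g [u [v [sg pu qv]]]] := common_factor (line_free_neq0 lp) npq.
have [su|sg1] := irrp _ _ pu; last by rewrite sg1 in sg.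
have [lu _] : line_free u /\ line_free g by apply/line_freeM; rewrite -pu.
have [|a a0 def_u] := line_free_const lu; first by rewrite su.
exists (v * a^-1%:P%:P); rewrite pu qv -mulrA; congr (_ * _).
by rewrite mulrA def_u -!polyCM mulVf // !polyC1 mul1r.
Qed.

Lemma exists_irred f : line_free f -> (1 < size f)%N ->
  exists p r, irred p /\ f = p * r.
Proof.
have [n] := ubnP (size f); elim: n f => // n IH f sf lf s1.
have [irrf|] := pselect (forall u v, f = u * v -> size u = 1%N \/ size v = 1%N).
  by exists f, 1; rewrite mulr1.
move=> /existsNP[u /existsNP[v /not_implyP[fuv /not_orP[su sv]]]].
have [lu lv] : line_free u /\ line_free v by apply/line_freeM; rewrite -fuv.
have su0 : (1 < size u)%N.
  by rewrite ltn_neqAle size_poly_gt0 line_free_neq0 // andbT; apply/eqP=> /esym.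
have sv0 : (1 < size v)%N.
  by rewrite ltn_neqAle size_poly_gt0 line_free_neq0 // andbT; apply/eqP=> /esym.
have [|p [r [irrp def_u]]] := IH u _ lu su0.
  rewrite -ltnS (leq_trans _ sf) // fuv size_mul ?line_free_neq0 //.
  by rewrite -(subnKC sv0) addnS ltnS -addSnnS leq_addr.
by exists p, (r * v); rewrite fuv def_u mulrA.
Qed.

(** Divide by p as long as p divides the quotient; when it no longer does, the two
    are coprime because p is irreducible. *)
Lemma exact_power p f : irred p -> line_free f -> (exists r, f = p * r) ->
  exists m r, [/\ (0 < m)%N, f = p ^+ m * r & coprimep p r].
Proof.
move=> irrp; have [lp sp _] := irrp.
have [n] := ubnP (size f); elim: n f => // n IH f sf lf [r def_f].
have [_ lr] : line_free p /\ line_free r by apply/line_freeM; rewrite -def_f.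
have [cpr|[w def_r]] := irred_coprime r irrp; first by exists 1%N, r; rewrite expr1.
have [||m [t [m0 def_r' cpt]]] := IH r _ lr.
- rewrite -ltnS (leq_trans _ sf) // def_f size_mul ?line_free_neq0 //.
  by rewrite -(subnKC sp) !addSn /= !ltnS leq_addl.
- by exists w; rewrite mulrC.
by exists m.+1, t; rewrite exprS -mulrA -def_r'.
Qed.

Lemma irred_factor f : line_free f -> (1 < size f)%N ->
  exists p m r, [/\ irred p, (0 < m)%N, f = p ^+ m * r & coprimep p r].
Proof.
move=> lf sf; have [p [r [irrp def_f]]] := exists_irred lf sf.
have [|m [t [m0 def_f' cpt]]] := exact_power irrp lf; first by exists r.
by exists p, m, t.
Qed.

(** The coprimality makes n the exact exponent of p in f. *)
Definition uniform_mult m f := forall p n r,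
  irred p -> (0 < n)%N -> f = p ^+ n * r -> coprimep p r -> n = m.

Lemma coprime_cofactor p q r : coprimep p r -> (exists s, r = q * s) ->
  coprimep q p.
Proof.
move=> cpr [s def_r]; rewrite coprimep_sym; apply: coprimep_dvdl cpr.
by rewrite def_r dvdp_mulr // dvdpp.
Qed.

(** Split off the factors p ^+ m one after the other; an m-th root of the
    remaining constant exists because C is algebraically closed. *)
Lemma uniform_power m f : (0 < m)%N -> line_free f -> uniform_mult m f ->
  exists g, f = g ^+ m.
Proof.
move=> m0; have [n] := ubnP (size f); elim: n f => // n IH f sf lf uf.
have [s1|s1] := leqP (size f) 1.
  have [a a0 def_f] := line_free_const lf s1.
  have [b ab] := @solve_monicpoly C m (fun i => if i == 0%N then a else 0) m0.
  exists b%:P%:P; rewrite def_f -!polyC_exp ab.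
  case: (m) m0 => // k _; rewrite big_ord_recl /= mulr1.
  by rewrite big1 ?addr0 // => i _; rewrite mul0r.
have [p [k [r [irrp k0 def_f cpr]]]] := irred_factor lf s1.
have km : k = m by exact: uf def_f cpr.
have [lp sp _] := irrp.
have [lpk lr] : line_free (p ^+ k) /\ line_free r by apply/line_freeM; rewrite -def_f.
have [||t def_r] := IH r _ lr.
- rewrite -ltnS (leq_trans _ sf) // def_f size_mul ?line_free_neq0 //.
  rewrite size_expf ?line_free_neq0 //=.
  rewrite ltnS -[X in (X < _)%N]add0n ltn_add2r muln_gt0 k0 andbT.
  by rewrite -subn1 subn_gt0.
- move=> q l s irrq l0 def_r cqs; apply: (uf q l (p ^+ k * s)) => //.
    by rewrite def_f def_r mulrCA.
  rewrite coprimepMr cqs andbT coprimep_expr //.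
  apply: coprime_cofactor cpr _; exists (q ^+ l.-1 * s).
  by rewrite mulrA -exprS prednK.
by exists (p * t); rewrite def_f def_r km exprMn.
Qed.

Hypothesis char0 : [pchar C] =i pred0.

(** The leading coefficient is multiplied by the degree. *)
Lemma deriv_neq0 p : (1 < size p)%N -> p^`() != 0.
Proof.
move=> sp; apply/eqP => /(congr1 (fun q => q`_(size p).-2)).
rewrite coef0 coef_deriv -mulr_natr => /eqP; rewrite mulf_eq0.
have -> : (size p).-2.+1 = (size p).-1 by case: (size p) sp => [|[]].
rewrite -/(lead_coef p) lead_coef_eq0 -polyC_natr polyC_eq0.
rewrite ((pcharf0P _).1 char0).
by case: (size p) (size_poly_eq0 p) sp => [|[|n]] // <-.
Qed.

(** The derivative has a smaller degree, so p cannot divide it. *)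
Lemma irred_coprime_deriv p : irred p -> coprimep p p^`().
Proof.
move=> irrp; have [lp sp _] := irrp.
have [//|[w def_p']] := irred_coprime p^`() irrp.
have p'0 := deriv_neq0 sp; have p0 := line_free_neq0 lp.
have w0 : w != 0 by apply: contraNneq p'0 => w0; rewrite def_p' w0 mul0r.
have := lt_size_deriv p0; rewrite def_p' size_mul //.
by rewrite -(prednK (_ : 0 < size w)%N) ?size_poly_gt0 // addSn /= ltnNge leq_addl.
Qed.

(** Otherwise an irreducible p divides both f = p * r and its derivative
    p^`() * r + p * r^`(), hence p^`() * r, although it is coprime to both
    factors. *)
Lemma squarefree_coprime_deriv f : line_free f -> uniform_mult 1 f ->
  coprimep f f^`().
Proof.
move=> lf uf; apply: contraT => ncf.
have [g [u [v [sg fu f'v]]]] := common_factor (line_free_neq0 lf) ncf.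
have [lu lg] : line_free u /\ line_free g by apply/line_freeM; rewrite -fu.
have [p [s [irrp def_g]]] := exists_irred lg sg; have [lp sp _] := irrp.
have [|m [r [m0 def_f cpr]]] := exact_power irrp lf.
  by exists (u * s); rewrite fu def_g mulrCA.
have m1 := uf _ _ _ irrp m0 def_f cpr; rewrite m1 expr1 in def_f.
have pd : p %| p^`() * r.
  have -> : p^`() * r = p * (v * s - r^`()).
    rewrite mulrBr mulrCA -def_g -f'v def_f derivM addrK //.
  by rewrite dvdp_mulr // dvdpp.
have cpp : coprimep p (p^`() * r) by rewrite coprimepMr irred_coprime_deriv.
have := coprimep_dvdl pd cpp; rewrite coprimepp => /eqP sp1.
by rewrite sp1 in sp.
Qed.

Lemma evalY_deriv f b : evalY b f^`() = (evalY b f)^`().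
Proof. by rewrite -deriv_map. Qed.

(** There is a Bezout relation u * p + v * q = c over C[y].  At a common root of
    p(., b) and q(., b) its left-hand side vanishes, hence c vanishes at b. *)
Lemma generic_no_common_root p q : coprimep p q ->
  exists2 c : {poly C}, c != 0 & forall b a, c.[b] != 0 ->
    root (evalY b p) a -> ~~ root (evalY b q) a.
Proof.
move=> /Bezout_coprimepP[[u v] /eqpP[[c1 c2] /= /andP[_ c0] eq]].
exists c2 => // b a cb pa; apply/negP => qa.
move: eq => /(congr1 (fun h => (evalY b h).[a])).
rewrite -!mul_polyC mulr1 !rmorphM rmorphD !rmorphM /= !evalY_polyC.
rewrite !hornerE (rootP pa) (rootP qa) !mulr0 addr0 mulr0 => /esym/eqP.
by rewrite (negPf cb).
Qed.

Lemma mup_simple (h : {poly C}) a : root h a -> ~~ root h^`() a -> mup a h = 1%N.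
Proof.
move=> /factor_theorem[q ->]; rewrite derivM derivXsubC mulr1 rootE !hornerE.
rewrite subrr mulr0 add0r => qa.
by rewrite mupMr ?rootE // (mup_XsubCX 1) eqxx.
Qed.

(** For generic b the root a of p(., b) is simple and is not a root of r(., b),
    so its multiplicity in f(., b) comes from the exponent m. *)
Lemma generic_mup f p m r : line_free f -> irred p -> f = p ^+ m * r ->
    coprimep p r ->
  exists2 c : {poly C}, c != 0 & forall b a, c.[b] != 0 ->
    root (evalY b p) a -> mup a (evalY b f) = m.
Proof.
move=> lf irrp def_f cpr.
have [lp _ _] := irrp.
have [c1 c10 H1] := generic_no_common_root cpr.
have [c2 c20 H2] := generic_no_common_root (irred_coprime_deriv irrp).
exists (c1 * c2); first by rewrite mulf_neq0.
move=> b a; rewrite hornerM mulf_eq0 negb_or => /andP[cb1 cb2] pa.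
rewrite def_f rmorphM rmorphXn /= mupMl ?(H1 _ _ cb1) //.
rewrite mupX; last by case: lp.
by rewrite mup_simple ?muln1 // -evalY_deriv H2.
Qed.

Lemma horner_evalY f a b : (evalY b f).[a] = f.[a%:P].[b].
Proof. by rewrite -evalYE horner2_swapXY. Qed.

(** Each of the finitely many excluded ordinates b excludes only the roots of
    f(., b), which is not zero. *)
Lemma generic_fibre f c : line_free f -> c != 0 ->
  exists2 e : {poly C}, e != 0 & forall a b, e.[a] != 0 ->
    root f.[a%:P] b -> c.[b] != 0.
Proof.
move=> [_ fy] c0; case: (closed_field_poly_normal c) => s def_c.
exists (\prod_(b <- s) evalY b f).
  by rewrite prodf_seq_neq0; apply/allP => b _ /=; apply: fy.
move=> a b; rewrite horner_prod prodf_seq_neq0 => /allP sa fab.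
have bs : b \notin s.
  by apply/negP => /sa /=; rewrite horner_evalY (rootP fab) eqxx.
rewrite def_c hornerZ mulf_neq0 ?lead_coef_eq0 //.
by rewrite -/(root _ _) root_prod_XsubC.
Qed.

(** p has positive degree in y, and its degree does not drop outside the zeros of
    its leading coefficient in y. *)
Lemma generic_root p : line_free p -> (1 < size p)%N ->
  exists2 e : {poly C}, e != 0 & forall a, e.[a] != 0 ->
    exists b, root p.[a%:P] b.
Proof.
move=> lp sp; have := line_free_sizeY lp sp; rewrite sizeYE => sp'.
exists (lead_coef (swapXY p)).
  by rewrite lead_coef_eq0 swapXY_eq0 line_free_neq0.
move=> a ea; suff /closed_rootP : size p.[a%:P] != 1%N by [].
by rewrite horner_polyC size_map_poly_id0 // neq_ltn sp' orbT.
Qed.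

End Factor.

(** * Multiplicities in a map of tuples *)

Section Tuples.
Variable C : closedFieldType.
Implicit Types (f g p q r : {poly {poly C}}) (a b c : C).

Lemma y_list_fin n f a : size f = n.+1 -> sizeY f = n.+1 ->
  y_list n f (Some a) = form_zeros n f.[a%:P].
Proof. by move=> sf sYf; rewrite /y_list sliceE bislice_fin ?sf ?sYf. Qed.

Lemma x_list_fin n f b : size f = n.+1 -> sizeY f = n.+1 ->
  x_list n f (Some b) = form_zeros n (evalY b f).
Proof.
move=> sf sYf; rewrite /x_list y_list_fin ?evalYE //; first by rewrite -sizeYE.
by rewrite sizeYE swapXYK.
Qed.

Lemma mem_y_list_fin n f a b : poly_correspondence n f ->
  (Some b \in y_list n f (Some a)) = root f.[a%:P] b.
Proof.
move=> pf; have [_ [sf sYf] _ _ _] := pf.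
have [fx fy] := poly_correspondence_line_free pf.
have sfa : (size f.[a%:P]%R <= n.+1)%N by rewrite -sYf max_size_evalC.
by rewrite y_list_fin // mem_form_zeros // form_eval_fin.
Qed.

Lemma count_x_list_fin n f a b : poly_correspondence n f ->
  count_mem (Some a) (x_list n f (Some b)) = mup a (evalY b f).
Proof.
move=> pf; have [_ [sf sYf] _ _ _] := pf.
have [fx fy] := poly_correspondence_line_free pf.
by rewrite x_list_fin // count_form_zeros_fin.
Qed.

(** Over a generic a there are a point b of p = 0 and a point b' of q = 0.  The
    tuples of b and b' coincide, and a occurs in them k and l times. *)
Lemma tuples_uniform_mult n f p q k l r s :
    [pchar C] =i pred0 -> map_of_tuples n f ->
    irred p -> (0 < k)%N -> f = p ^+ k * r -> coprimep p r ->
    irred q -> (0 < l)%N -> f = q ^+ l * s -> coprimep q s ->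
  k = l.
Proof.
move=> char0 [pf tf _] irrp k0 fp cp irrq l0 fq cq.
have lf := poly_correspondence_line_free pf.
have [[lp sp _] [lq sq _]] := (irrp, irrq).
have [c1 c10 H1] := generic_mup char0 lf irrp fp cp.
have [c2 c20 H2] := generic_mup char0 lf irrq fq cq.
have [e1 e10 G1] := generic_fibre lf c10.
have [e2 e20 G2] := generic_fibre lf c20.
have [e3 e30 G3] := generic_root lp sp.
have [e4 e40 G4] := generic_root lq sq.
(* a avoids the exceptional sets of both factors at once *)
have := mulf_neq0 (mulf_neq0 e10 e20) (mulf_neq0 e30 e40).
move=> /closed_nonrootP[a]; rewrite !rootM !negb_or -andbA.
move=> /and4P[a1 a2 a3 a4].
have [b pb] := G3 a a3; have [b' qb'] := G4 a a4.
have fb : root f.[a%:P] b.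
  by rewrite fp hornerM horner_exp rootM -(prednK k0) exprS rootM pb.
have fb' : root f.[a%:P] b'.
  by rewrite fq hornerM horner_exp rootM -(prednK l0) exprS rootM qb'.
have := tf (Some a) (Some b) (Some b').
rewrite !mem_y_list_fin // => /(_ fb fb') /permP /(_ (pred1 (Some a))).
rewrite !count_x_list_fin // H1 ?H2 //.
- exact: G2 fb'.
- by rewrite rootE horner_evalY.
- exact: G1 fb.
- by rewrite rootE horner_evalY.
Qed.

(** At infinity this is the multiplicativity of leading coefficients, which is
    why the degrees have to be exact. *)
Lemma slice_exp k m f g x : size g = k.+1 -> sizeY g = k.+1 ->
    size f = (k * m).+1 -> sizeY f = (k * m).+1 -> f = g ^+ m ->
  slice (k * m) f x = slice k g x ^+ m.
Proof.
move=> sg sYg sf sYf def_f; rewrite !sliceE; case: x => [a|].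
  by rewrite !bislice_fin ?sf ?sYf ?sg ?sYg // def_f horner_exp.
rewrite !bislice_inf ?sYf ?sYg //.
have -> : f`_(k * m) = lead_coef f by rewrite lead_coefE sf.
have -> : g`_k = lead_coef g by rewrite lead_coefE sg.
by rewrite def_f lead_coef_exp.
Qed.

Lemma sizeY_exp m g : g != 0 -> sizeY (g ^+ m) = ((sizeY g).-1 * m).+1.
Proof. by move=> g0; rewrite !sizeYE rmorphXn size_expf ?swapXY_eq0. Qed.

(** Every list attached to f repeats m times the corresponding list attached to
    g, and the two curves have the same points, hence the same components. *)
Lemma map_of_tuples_root n m f g : map_of_tuples n f -> (0 < m)%N ->
  f = g ^+ m -> exists k, n = (k * m)%N /\ map_of_tuples k g.
Proof.
move=> [pf tx ty] m0 def_f; have [n0 [sf sYf] _ noX noY] := pf.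
have f0 := line_free_neq0 (poly_correspondence_line_free pf).
have g0 : g != 0 by move: f0; rewrite def_f expf_eq0 m0.
pose k := (size g).-1.
have sg : size g = k.+1 by rewrite /k prednK ?size_poly_gt0.
have nk : n = (k * m)%N by apply: succn_inj; rewrite -sf def_f size_expf.
have k0 : (0 < k)%N by move: n0; rewrite nk muln_gt0 => /andP[].
have sYg : sizeY g = k.+1.
  have := sYf; rewrite def_f sizeY_exp // nk => /succn_inj/eqP.
  rewrite eqn_pmul2r // => /eqP <-; rewrite prednK // lt0n sizeY_eq0.
  exact: g0.
subst n; exists k; split=> //.
have sliceX x := slice_exp x sg sYg sf sYf def_f.
have sliceY x : slice (k * m) (swapXY f) x = slice k (swapXY g) x ^+ m.
  apply: slice_exp; rewrite ?sizeYE ?swapXYK -?sizeYE //.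
  by rewrite def_f rmorphXn.
have sx x : slice k g x != 0.
  by have := slice_neq0 x pf; rewrite sliceX expf_eq0 m0.
have sy y : slice k (swapXY g) y != 0.
  by have := slice_neq0 y (poly_correspondence_swap pf); rewrite sliceY expf_eq0 m0.
have cntX x z : count_mem z (y_list (k * m) f x) = (m * count_mem z (y_list k g x))%N.
  by rewrite /y_list sliceX count_form_zerosX.
have cntY y z : count_mem z (x_list (k * m) f y) = (m * count_mem z (x_list k g y))%N.
  by rewrite /x_list /y_list sliceY count_form_zerosX.
have memX x z : (z \in y_list k g x) = (z \in y_list (k * m) f x).
  by rewrite -!has_pred1 !has_count cntX muln_gt0 m0.
have memY y z : (z \in x_list k g y) = (z \in x_list (k * m) f y).
  by rewrite -!has_pred1 !has_count cntY muln_gt0 m0.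
have complE : completion k g = completion (k * m) f.
  apply/seteqP; split=> -[x y]; rewrite /completion /= !bihomE => /eqP H; apply/eqP.
    rewrite -mem_form_zeros ?size_slice //; last by rewrite slice_neq0.
    by rewrite -[_ \in _]memX /y_list mem_form_zeros ?size_slice.
  rewrite -mem_form_zeros ?size_slice //; last by rewrite sx.
  by rewrite [_ \in _]memX /y_list mem_form_zeros ?size_slice ?slice_neq0.
split.
- split=> //; rewrite ?complE //; split; exists [::] => x _.
    by rewrite sx /y_list size_form_zeros ?size_slice.
  by rewrite sy /y_list size_form_zeros ?size_slice.
- move=> x1 y y'; rewrite !memX => yx y'x.
  apply/allP => z _ /=; rewrite -(eqn_pmul2l m0) -!cntY.
  by rewrite (permP (tx x1 y y' yx y'x)).
move=> y1 x x'; rewrite !memY => xy x'y.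
apply/allP => z _ /=; rewrite -(eqn_pmul2l m0) -!cntX.
by rewrite (permP (ty y1 x x' xy x'y)).
Qed.

End Tuples.

(** * Separation of the variables *)

Section Separation.
Variable C : closedFieldType.
Implicit Types (f g : {poly {poly C}}) (p q h kappa lambda mu nu : {poly C}).

Definition separated (c : C) kappa lambda mu nu : {poly {poly C}} :=
  c%:P *: (kappa^:P * nu%:P - lambda^:P * mu%:P).

Lemma coef_separated c kappa lambda mu nu i j :
  (separated c kappa lambda mu nu)`_i`_j =
    c * (kappa`_i * nu`_j - lambda`_i * mu`_j).
Proof. by rewrite coefZ coefB !coefMC !coef_map coefCM coefB !coefCM. Qed.

Lemma swap_separated c kappa lambda mu nu :
  swapXY (separated c kappa lambda mu nu) = separated c nu mu lambda kappa.
Proof.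
apply/polyP => i; apply/polyP => j; rewrite coef_swapXY !coef_separated.
by rewrite ![_`_j * _]mulrC.
Qed.

Lemma horner_separated c kappa lambda mu nu a :
  (separated c kappa lambda mu nu).[a%:P] =
    c *: (kappa.[a] *: nu - lambda.[a] *: mu).
Proof.
rewrite hornerZ hornerD hornerN !hornerM !hornerC !horner_map /=.
by rewrite !mul_polyC.
Qed.

Lemma evalY_separated c kappa lambda mu nu b :
  evalY b (separated c kappa lambda mu nu) =
    c *: (nu.[b] *: kappa - mu.[b] *: lambda).
Proof. by rewrite -evalYE swap_separated horner_separated. Qed.

Lemma slice_separated n c kappa lambda mu nu x :
    (size mu <= n.+1)%N -> (size nu <= n.+1)%N ->
  slice n (separated c kappa lambda mu nu) x =
    c *: (form_eval n kappa x *: nu - form_eval n lambda x *: mu).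
Proof.
move=> smu snu; apply/polyP => j; rewrite coef_poly.
case: ltnP => [_|nj]; last first.
  rewrite nth_default // (leq_trans _ nj) // (leq_trans (size_scale_leq _ _)) //.
  rewrite (leq_trans (size_polyD _ _)) // geq_max size_polyN.
  by rewrite !(leq_trans (size_scale_leq _ _)).
rewrite coefZ coefB !coefZ !mulr_suml -sumrB mulr_sumr; apply: eq_bigr => i _.
rewrite coef_separated -mulrA; congr (_ * _).
by rewrite mulrBl mulrAC [X in _ - X]mulrAC.
Qed.

(** In a plane, the solutions of a nonzero linear equation form a line. *)
Lemma proportional (K L v m v' m' : C) :
    ~~ ((K == 0) && (L == 0)) ->
    ~~ ((v == 0) && (m == 0)) -> ~~ ((v' == 0) && (m' == 0)) ->
    K * v = L * m -> K * v' = L * m' ->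
  exists t, [/\ t != 0, v' = t * v & m' = t * m].
Proof.
move=> KL vm vm' e e'; have [K0|K0] := eqVneq K 0.
  move: KL e e'; rewrite K0 eqxx /= !mul0r => L0 /esym/eqP + /esym/eqP.
  rewrite !mulf_eq0 (negPf L0) /= => /eqP m0 /eqP m'0.
  move: vm vm'; rewrite m0 m'0 eqxx !andbT => v0 v'0.
  exists (v' / v); rewrite mulf_neq0 ?invr_eq0 // divfK // mulr0.
  by [].
have ev : v = L / K * m by apply: (mulfI K0); rewrite e mulrA mulrCA divff // mulr1.
have ev' : v' = L / K * m' by apply: (mulfI K0); rewrite e' mulrA mulrCA divff // mulr1.
have m0 : m != 0.
  by apply: contraNneq vm => m0; rewrite ev m0 mulr0 eqxx.
have m'0 : m' != 0.
  by apply: contraNneq vm' => m'0; rewrite ev' m'0 mulr0 eqxx.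
exists (m' / m); rewrite mulf_neq0 ?invr_eq0 // divfK //; split=> //.
by rewrite ev ev' mulrCA divfK.
Qed.

(** The points y over x satisfy kappa(x) nu(y) = lambda(x) mu(y), which
    determines nu(y) and mu(y) up to a common factor, and the slice at y depends
    only on these two values. *)
Lemma separated_tuples n f c kappa lambda mu nu :
    (size kappa <= n.+1)%N -> (size lambda <= n.+1)%N ->
    (size mu <= n.+1)%N -> (size nu <= n.+1)%N ->
    poly_correspondence n f -> f = separated c kappa lambda mu nu ->
  forall x, {in y_list n f x &, forall y y',
    perm_eq (x_list n f y) (x_list n f y')}.
Proof.
move=> sk sl sm sn pf def_f x y y'.
have pf' := poly_correspondence_swap pf.
have sx := slice_neq0 x pf; have sy z := slice_neq0 z pf'.
have c0 : c != 0.
  by apply: contraNneq sx => c0; rewrite def_f slice_separated // c0 scale0r.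
rewrite /y_list !mem_form_zeros ?size_slice //.
have slx : slice n f x =
    c *: (form_eval n kappa x *: nu - form_eval n lambda x *: mu).
  by rewrite def_f; apply: slice_separated.
have sly z : slice n (swapXY f) z =
    c *: (form_eval n nu z *: kappa - form_eval n mu z *: lambda).
  by rewrite def_f swap_separated; apply: slice_separated.
have nz (u v : C) p q : c *: (u *: p - v *: q) != 0 -> ~~ ((u == 0) && (v == 0)).
  apply: contra => /andP[/eqP -> /eqP ->].
  by rewrite !scale0r subr0 scaler0.
have on_curve z : form_eval n (slice n f x) z == 0 ->
    form_eval n kappa x * form_eval n nu z = form_eval n lambda x * form_eval n mu z.
  rewrite slx => /eqP H; apply/eqP; rewrite -subr_eq0 -(mulrI_eq0 _ (mulfI c0)).
  apply/eqP; rewrite -{}H {3 4}/form_eval !mulr_sumr -sumrB mulr_sumr.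
  apply: eq_bigr => j _; rewrite coefZ coefB !coefZ -mulrA; congr (_ * _).
  by rewrite mulrBl !mulrA.
move=> /on_curve ey /on_curve ey'; rewrite /x_list /y_list.
have [|||t [t0 ev em]] := proportional _ _ _ ey ey'.
- by apply: (nz _ _ nu mu); rewrite -slx.
- by apply: (nz _ _ kappa lambda); rewrite -sly.
- by apply: (nz _ _ kappa lambda); rewrite -sly.
have -> : slice n (swapXY f) y' = t *: slice n (swapXY f) y.
  by rewrite !sly ev em -!scalerA -scalerBr !scalerA mulrC.
by rewrite perm_sym perm_form_zerosZ.
Qed.

Lemma separable_map_of_tuples n f : poly_correspondence n f ->
  separable_variables n f -> map_of_tuples n f.
Proof.
move=> pf [kappa [lambda [mu [nu [[sk sl _ _] [sm sn _ _] [c _ def_f]]]]]].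
split=> //; first exact: (@separated_tuples n f c kappa lambda mu nu).
have pf' := poly_correspondence_swap pf.
have def_f' : swapXY f = separated c nu mu lambda kappa.
  by rewrite def_f swap_separated.
move=> y x x' xy x'y.
have := separated_tuples sn sm sl sk pf' def_f' xy x'y.
by rewrite /x_list swapXYK.
Qed.

Lemma coprime_fractional n p q : q != 0 -> coprimep p q ->
  maxn (size p) (size q) = n.+1 -> fractional n p q.
Proof.
move=> q0 cpq mpq; have := leqnn n.+1; rewrite -{1}mpq geq_max => /andP[sp sq].
split=> //; rewrite /ratmap_degree.
have g0 : gcdp p q != 0 by rewrite gcdp_eq0 negb_and q0 orbT.
by rewrite !size_divp // (eqP cpq) !subn0 mpq.
Qed.

(** The coprimality with the derivative provides an ordinate b such that
    h = f(., b) has n distinct roots.  The slices of f at these roots are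
    multiples of one polynomial q, so f - f(x, y0) q(y) / q(y0) is divisible
    by h. *)
Lemma tuples_separable n f : map_of_tuples n f -> coprimep f f^`() ->
  separable_variables n f.
Proof.
move=> [pf _ ty] cff.
have [n0 [sf sYf] _ _ _] := pf; have lf := poly_correspondence_line_free pf.
have [fx fy] := lf; have f0 := line_free_neq0 lf.
have [c c0 Hc] := generic_no_common_root cff.
have /closed_nonrootP[b] : c * lead_coef f != 0 by rewrite mulf_neq0 ?lead_coef_eq0.
rewrite rootM negb_or => /andP[cb lb]; pose h := evalY b f.
have sh : size h = n.+1 by rewrite size_map_poly_id0.
have h0 : h != 0 by apply: fy.
case: (closed_field_poly_normal h) => s def_h.
have ss : size s = n.
  apply: succn_inj; rewrite -sh def_h size_scale ?lead_coef_eq0 //.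
  by rewrite size_prod_XsubC.
have hs z : root h z = (z \in s).
  by rewrite def_h rootZ ?lead_coef_eq0 // root_prod_XsubC.
have us : uniq s.
  apply: count_mem_uniq => z; rewrite -mu_prod_XsubC.
  rewrite -(mupZ _ _ (_ : lead_coef h != 0)) ?lead_coef_eq0 // -def_h -hs.
  have [hz|hz] := boolP (root h z); last by rewrite mupNroot.
  by rewrite mup_simple // -evalY_deriv Hc.
case: s => [|x1 s'] in def_h ss hs us *; first by rewrite -ss in n0.
set s := x1 :: s' in def_h ss hs us *.
(* q may be taken to be the slice at any of the roots of h. *)
pose q := f.[x1%:P]; have q0 : q != 0 by apply: fx.
have /closed_nonrootP[y0 qy0] := q0.
pose kappa := evalY y0 f; pose nu := q.[y0]^-1 *: q.
have prop_q z : z \in s -> exists t, f.[z%:P] = t *: q.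
  have inx u : u \in s -> Some u \in x_list n f (Some b).
    move=> us'; rewrite x_list_fin // mem_form_zeros ?sh //.
    by rewrite form_eval_fin ?sh // -rootE hs.
  move=> zs; have := ty _ _ _ (inx z zs) (inx x1 (mem_head _ _)).
  rewrite !y_list_fin // => /perm_form_zeros_prop -> //.
  by eexists.
pose g := f - kappa^:P * nu%:P.
have gz z : g.[z%:P] = f.[z%:P] - kappa.[z] *: nu.
  by rewrite hornerD hornerN hornerM hornerC horner_map /= mul_polyC.
have groots : all (root g) [seq z%:P | z <- s].
  apply/allP => _ /mapP[z zs ->]; rewrite rootE gz.
  have [t ft] := prop_q z zs.
  rewrite horner_evalY ft hornerZ /nu scalerA mulfK ?subrr //.
have [|w def_g] := uniq_roots_prod_XsubC groots.
  by rewrite (map_uniq_roots polyC).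
have {}def_g : g = (w * (lead_coef h)^-1%:P%:P) * h^:P.
  rewrite def_g -mulrA big_map; congr (_ * _).
  rewrite {2}def_h -mul_polyC rmorphM /= map_polyC /= mulrA -!polyCM.
  rewrite mulVf ?lead_coef_eq0 // !polyC1 mul1r rmorph_prod.
  by apply: eq_bigr => z _; rewrite rmorphB /= map_polyX map_polyC.
set W := w * _ in def_g.
(* h has the full degree n in x, so the cofactor W does not involve x. *)
have sW : (size W <= 1)%N.
  have [->|W0] := eqVneq W 0; first by rewrite size_poly0.
  have : (size g <= n.+1)%N.
    rewrite (leq_trans (size_polyD _ _)) // geq_max size_polyN sf leqnn /=.
    rewrite mulrC mul_polyC (leq_trans (size_scale_leq _ _)) //.
    by rewrite size_map_polyC (leq_trans (size_poly _ _)) ?sf.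
  rewrite def_g size_mul ?map_polyC_eq0 // size_map_polyC sh addnS /=.
  by rewrite -[X in (_ <= X)%N]add1n leq_add2r.
pose r := W`_0; have def_W : W = r%:P by apply: size1_polyC.
have def_f : f = separated 1 kappa h (- r) nu.
  rewrite /separated scale1r polyCN mulrN opprK -[LHS](subrK (kappa^:P * nu%:P)).
  by rewrite -/g def_g def_W addrC [r%:P * _]mulrC.
have snu : (size nu <= n.+1)%N.
  by rewrite (leq_trans (size_scale_leq _ _)) // -sYf max_size_evalC.
have sr : (size (- r)%R <= n.+1)%N.
  (* The degree of r is read off a slice at which h does not vanish. *)
  have /closed_nonrootP[z hz] := h0.
  have : (size g.[z%:P]%R <= n.+1)%N.
    rewrite gz (leq_trans (size_polyD _ _)) // geq_max size_polyN.
    by rewrite -{1}sYf max_size_evalC (leq_trans (size_scale_leq _ _)).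
  rewrite def_g def_W hornerM hornerC horner_map /= mulrC mul_polyC.
  by rewrite size_scale // size_polyN.
have nu0 : nu != 0 by rewrite scaler_eq0 negb_or invr_eq0 q0 andbT.
have no_root (p p' : {poly C}) :
    (forall z, root p z -> root p' z -> False) -> coprimep p p'.
  move=> pp'; apply/Pdiv.ClosedField.coprimepP => z pz.
  by apply/negP => p'z; apply: (pp' z).
exists kappa, h, (- r), nu; split.
- apply: coprime_fractional => //.
    apply: no_root => z /rootP kz /rootP hz; have := fx z.
    by rewrite def_f horner_separated kz hz !scale0r subr0 scaler0 eqxx.
  by rewrite sh; apply/maxn_idPr; rewrite (leq_trans (size_poly _ _)) ?sf.
- apply: coprime_fractional => //.
    apply: no_root => z /rootP rz /rootP nz; have := fy z.
    by rewrite def_f evalY_separated rz nz !scale0r subr0 scaler0 eqxx.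
  apply/eqP; rewrite eqn_leq geq_max sr snu /= ltnNge geq_max.
  apply/negP => /andP[sr' snu'].
  suff : (sizeY f <= n)%N by rewrite sYf ltnn.
  apply/bigmax_leqP => i _; apply/leq_sizeP => j nj.
  move: (i : nat) => {}i; rewrite def_f coef_separated.
  by rewrite (leq_sizeP _ _ snu') // (leq_sizeP _ _ sr') // !mulr0 subrr mulr0.
by exists 1; rewrite ?oner_eq0.
Qed.

End Separation.

Theorem theorem2p3 (R : realType) (d : nat) (f : {poly {poly R[i]}}) :
  (2 <= d)%N ->
  poly_correspondence d f ->
  ~ (exists (k : nat) (g : {poly {poly R[i]}}),
       [/\ (k %| d)%N, k <> d, map_of_tuples k g & f = g ^+ (d %/ k)]) ->
  map_of_tuples d f <-> separable_variables d f.
Proof.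
move=> d2 pf not_power; split; last exact: separable_map_of_tuples.
move=> mf; have d0 := ltnW d2; have [_ [sf _] _ _ _] := pf.
have char0 : [pchar R[i]] =i pred0 by apply: Num.Theory.pchar_num.
have lf := poly_correspondence_line_free pf.
apply: tuples_separable => //; apply: squarefree_coprime_deriv => //.
have sf1 : (1 < size f)%N by rewrite sf.
have [p [m [r [irrp m0 def_f cpr]]]] := irred_factor lf sf1.
have uf : uniform_mult m f.
  move=> q l s irrq l0 def_f' cqs.
  exact: tuples_uniform_mult mf irrq l0 def_f' cqs irrp m0 def_f cpr.
suff m1 : m = 1%N by rewrite -m1.
have [g def_g] := uniform_power m0 lf uf.
have [k [dk mg]] := map_of_tuples_root mf m0 def_g.
apply: contrapT => m1; apply: not_power; exists k, g.
have k0 : (0 < k)%N by move: d0; rewrite dk muln_gt0 => /andP[].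
split=> //; first by rewrite dk dvdn_mulr.
  move=> kd; apply: m1; apply/eqP; rewrite -(eqn_pmul2l k0) -dk muln1 kd.
  exact: eqxx.
by rewrite dk mulKn.
Qed.
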